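(* Let $f:\mathbb{R}^n\to\mathbb{R}$ be a differentiable $\gamma$-strongly quasiconvex function with modulus $\gamma>0$ whose gradient is $L$-Lipschitz continuous, $L>0$. Let $s=\frac1L$, $\alpha\in\left(0,\frac12\right)$ and $$\frac{1+\alpha^2-\sqrt{-15\alpha^4+2\alpha^2+1}}{8\alpha}<\beta<\min\left\{\alpha,\ \frac{1+\alpha^2+\sqrt{-15\alpha^4+2\alpha^2+1}}{8\alpha}\right\}.$$ Let $\{x_k\}$ be the sequence generated from initial points $x_0,x_1\in\mathbb{R}^n$ by, for $k\ge1$, $$y_k=x_k+\alpha(x_k-x_{k-1}),\qquad z_k=x_k+\beta(x_k-x_{k-1}),\qquad x_{k+1}=y_k-s\nabla f(z_k).$$ Then, for $x^*=\mathrm{argmin}_{\mathbb{R}^n}f$ and all $k\ge1$, $$f(x_k)-f(x^* )\le\mathcal{E}_1(1-\rho)^{k-1},\qquad \|x_k-x^*\|^2\le\frac{4\mathcal{E}_1}{\gamma}(1-\rho)^{k-1},\qquad \|x_k-x_{k-1}\|^2\le\frac{2\alpha\mathcal{E}_1}{L\beta}(1-\rho)^{k-1},$$ where $$\mathcal{E}_1:=f(x_1)-f(x^* )+\frac{L\beta}{2\alpha}\|x_1-x_0\|^2,\qquad \rho:=\min\left\{\frac{\frac{1}{2L}\left(1-\frac{\beta}{\alpha}\right)}{\frac{2L}{\gamma^2}+\frac{\beta}{2}},\ \frac{\frac{L}{2\alpha}\big((\alpha^2+1)\beta-4\alpha\beta^2-\alpha^3\big)}{\frac{\beta}{2}\l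eft(1+L\beta+\frac{L}{\alpha}\right)}\right\}.$$
   Context: $\mathbb{R}^n$ carries the Euclidean inner product and norm $\|\cdot\|$. A function $f:\mathbb{R}^n\to\mathbb{R}$ is $\gamma$-strongly quasiconvex with modulus $\gamma>0$ if for all $x,y\in\mathbb{R}^n$ and $\lambda\in[0,1]$, $f(\lambda y+(1-\lambda)x)\le\max\{f(y),f(x)\}-\lambda(1-\lambda)\frac{\gamma}{2}\|x-y\|^2$. A lower semicontinuous $\gamma$-strongly quasiconvex function on $\mathbb{R}^n$ has a unique minimizer, so $x^*=\mathrm{argmin}_{\mathbb{R}^n}f$ denotes that point. *)

(* Defs.v *)
From HB Require Import structures.
From mathcomp Require Import all_boot all_order all_algebra.
From mathcomp Require Import all_classical all_reals all_analysis.

Set Implicit Arguments.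
Unset Strict Implicit.
Unset Printing Implicit Defensive.

Import Order.TTheory GRing.Theory Num.Theory.
Import numFieldNormedType.Exports.

Local Open Scope classical_set_scope.
Local Open Scope ring_scope.

(* The library norm `|x| on 'rV[R]_n is the sup norm, so the Euclidean inner
   product and norm are defined here. The two norms are equivalent, so
   [differentiable] and the derivatives below, which the library builds on
   the sup norm, are the usual ones. *)
Definition dotv (R : realType) (n : nat) (u v : 'rV[R]_n) : R :=
  \sum_(i < n) u 0 i * v 0 i.

Definition enorm (R : realType) (n : nat) (u : 'rV[R]_n) : R :=
  Num.sqrt (dotv u u).

Definition grad (R : realType) (n : nat) (f : 'rV[R]_n -> R) (x : 'rV[R]_n) :
  'rV[R]_n := \row_(i < n) 'D_(delta_mx 0 i) f x.

Lemma dotv_grad (R : realType) (n : nat) (f : 'rV[R]_n -> R)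
  (x v : 'rV[R]_n) : differentiable f x -> 'd f x v = dotv (grad f x) v.
Proof.
move=> df; rewrite {1}(row_sum_delta v) linear_sum; apply: eq_bigr => i _.
by rewrite linearZ /= mxE deriveE// mulrC.
Qed.

Definition lipschitz_grad (R : realType) (n : nat) (L : R)
  (f : 'rV[R]_n -> R) : Prop :=
  forall x y : 'rV[R]_n, enorm (grad f x - grad f y) <= L * enorm (x - y).

Definition strongly_quasiconvex (R : realType) (n : nat) (gamma : R)
  (f : 'rV[R]_n -> R) : Prop :=
  forall (x y : 'rV[R]_n) (lambda : R), 0 <= lambda <= 1 ->
    f (lambda *: y + (1 - lambda) *: x) <=
      Num.max (f y) (f x)
      - lambda * (1 - lambda) * (gamma / 2) * enorm (x - y) ^+ 2.

Definition argmin (R : realType) (n : nat) (f : 'rV[R]_n -> R) :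
  set 'rV[R]_n := [set x | forall y, f x <= f y].

(* Main.v *)
Require Import Defs.
From HB Require Import structures.
From mathcomp Require Import all_boot all_order all_algebra.
From mathcomp Require Import all_classical all_reals all_analysis.
From mathcomp Require Import ring lra.

Set Implicit Arguments.
Unset Strict Implicit.
Unset Printing Implicit Defensive.

Import Order.TTheory GRing.Theory Num.Theory.
Import numFieldNormedType.Exports.

Local Open Scope classical_set_scope.
Local Open Scope ring_scope.

(** Write [d k = x k - x (k-1)], [g k = grad f (z k)] and follow the energy
    [E k = f (x k) - f xstar + L beta / (2 alpha) |d k|^2], whose value at
    [k = 1] is [E1].

    The energy decreases ([momentum_step_decrease]).  Comparing both
    [f (x (k+1))] and [f (x k)] with [f (z k)] through the quadratic bounds for
    a function with Lipschitz gradient ([taylor_lipschitz_grad]) leaves a cross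
    term [beta <g k, d k>]; the weight [L beta / (2 alpha)] is the one for
    which expanding [|d (k+1)|^2] cancels it.  What remains is
    [E (k+1) <= E k - c1 |g k|^2 - c2 |d k|^2], where [c1] and [c2] are the two
    numerators in [rho].  The window for [beta] says that [beta] lies between
    the roots of a quadratic polynomial, that is, [c2 > 0] ([beta_window]).

    The energy is controlled by the same two quantities ([energy_bound]):
    [E k <= A |g k|^2 + B |d k|^2], where [A] and [B] are the two denominators
    in [rho].  The point is a Polyak-Lojasiewicz inequality
    ([polyak_lojasiewicz]): by strong quasiconvexity the slope of [f] at [z] in
    the direction [z - xstar] is at least [gamma / 2 |z - xstar|^2]
    ([sqc_grad_argmin]), so the gradient bounds the distance to [xstar], and
    this distance bounds [f z - f xstar] because the gradient is Lipschitz and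
    vanishes at [xstar].

    As [rho A <= c1] and [rho B <= c2], both facts give
    [E (k+1) <= (1 - rho) E k], hence geometric decay.  The energy dominates
    [f (x k) - f xstar] and the weighted [|d k|^2], and integrating the slope
    bound along the segment from [xstar] to [x k] gives
    [gamma / 4 |x k - xstar|^2 <= f (x k) - f xstar] ([quadratic_growth]). *)

(** * The Euclidean inner product *)

Lemma dotvC (R : realType) (n : nat) (u v : 'rV[R]_n) : dotv u v = dotv v u.
Proof. by apply: eq_bigr => i _; rewrite mulrC. Qed.

Lemma dotvDl (R : realType) (n : nat) (u v w : 'rV[R]_n) :
  dotv (u + v) w = dotv u w + dotv v w.
Proof. by rewrite -big_split; apply: eq_bigr => i _; rewrite mxE mulrDl. Qed.

Lemma dotvZl (R : realType) (n : nat) (c : R) (u v : 'rV[R]_n) :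
  dotv (c *: u) v = c * dotv u v.
Proof. by rewrite mulr_sumr; apply: eq_bigr => i _; rewrite mxE mulrA. Qed.

Lemma dotvNl (R : realType) (n : nat) (u v : 'rV[R]_n) :
  dotv (- u) v = - dotv u v.
Proof. by rewrite -scaleN1r dotvZl mulN1r. Qed.

Lemma dotvDr (R : realType) (n : nat) (u v w : 'rV[R]_n) :
  dotv u (v + w) = dotv u v + dotv u w.
Proof. by rewrite dotvC dotvDl !(dotvC _ u). Qed.

Lemma dotvZr (R : realType) (n : nat) (c : R) (u v : 'rV[R]_n) :
  dotv u (c *: v) = c * dotv u v.
Proof. by rewrite dotvC dotvZl (dotvC v). Qed.

Lemma dotvNr (R : realType) (n : nat) (u v : 'rV[R]_n) :
  dotv u (- v) = - dotv u v.
Proof. by rewrite dotvC dotvNl (dotvC v). Qed.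

Definition dotvE := (dotvDl, dotvDr, dotvNl, dotvNr, dotvZl, dotvZr).

Lemma dotv_ge0 (R : realType) (n : nat) (u : 'rV[R]_n) : 0 <= dotv u u.
Proof. by apply: sumr_ge0 => i _; rewrite -expr2 sqr_ge0. Qed.

Lemma enorm_sqr (R : realType) (n : nat) (u : 'rV[R]_n) :
  enorm u ^+ 2 = dotv u u.
Proof. by rewrite sqr_sqrtr// dotv_ge0. Qed.

(** A form of the Cauchy-Schwarz inequality without square roots, read off from
    [0 <= |u - K v|^2]; so is the next lemma, its counterpart for lower
    bounds. *)
Lemma dotv_le_sqr (R : realType) (n : nat) (K : R) (u v : 'rV[R]_n) :
  0 < K -> dotv u u <= K ^+ 2 * dotv v v -> dotv u v <= K * dotv v v.
Proof.
move=> K0 uv; have := dotv_ge0 (u - K *: v).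
rewrite !dotvE (dotvC v u) => h; rewrite -(ler_pM2l K0); lra.
Qed.

Lemma sqr_le_dotv (R : realType) (n : nat) (c : R) (u v : 'rV[R]_n) :
  0 <= c -> c * dotv v v <= dotv u v -> c ^+ 2 * dotv v v <= dotv u u.
Proof.
move=> c0 /(ler_wpM2l c0) uv; have := dotv_ge0 (u - c *: v).
rewrite !dotvE (dotvC v u); lra.
Qed.

(** * Functions with Lipschitz gradient *)

Lemma is_derive_line (R : realType) (n : nat) (f : 'rV[R]_n -> R)
  (a v : 'rV[R]_n) (t : R) : differentiable f (a + t *: v) ->
  is_derive t 1 (fun r : R => f (a + r *: v)) (dotv (grad f (a + t *: v)) v).
Proof.
move=> df; rewrite -dotv_grad//.
have dline : is_diff t (fun r : R => a + r *: v) (fun r => r *: v).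
  by apply: is_diff_eq; rewrite add0r.
have dcomp : is_diff t (f \o (fun r : R => a + r *: v))
    ('d f (a + t *: v) \o (fun r : R => r *: v)) by exact: is_diff_comp.
split; first by apply/derivable1_diffP; case: dcomp.
rewrite deriveE; last by case: dcomp.
by rewrite diff_val /= scale1r.
Qed.

(** Integrates an affine lower bound on a derivative over the unit interval, by
    the mean value theorem.  Along a line it yields the quadratic bounds for
    functions with Lipschitz gradient as well as quadratic growth from a
    minimizer. *)
Lemma affine_derive_growth (R : realType) (phi dphi : R -> R) (c m : R) :
  (forall t : R, is_derive t 1 phi (dphi t)) ->
  (forall t : R, 0 < t < 1 -> c + m * t <= dphi t) ->
  phi 0 + c + m / 2 <= phi 1.
Proof.
move=> dphiP dphi_ge.
pose psi t := phi t - (c * t + m / 2 * t ^+ 2).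
have dpsi (t : R) : is_derive t 1 psi (dphi t - (c + m * t)).
  by apply: is_derive_eq; rewrite /GRing.scale /=; field.
have psi_cont : {within `[0, 1], continuous psi}.
  by apply: derivable_within_continuous => t _; case: (dpsi t).
have [t t01] := MVT ltr01 (fun t _ => dpsi t) psi_cont.
by move: t01; rewrite in_itv => /= /dphi_ge; rewrite /psi; lra.
Qed.

Lemma lipschitz_grad_dotv (R : realType) (n : nat) (L : R)
  (f : 'rV[R]_n -> R) (a v : 'rV[R]_n) (t : R) :
  0 < L -> lipschitz_grad L f -> 0 < t ->
  `|dotv (grad f (a + t *: v) - grad f a) v| <= L * t * dotv v v.
Proof.
move=> L0 lipf t0.
have Lt0 : 0 < L * t by exact: mulr_gt0.
set u := _ - _.
have uv : dotv u u <= (L * t) ^+ 2 * dotv v v.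
  have := lipf (a + t *: v) a.
  rewrite -/u [a + _]addrC addrK => /(lerXn2r 2).
  rewrite !nnegrE sqrtr_ge0 mulr_ge0 ?sqrtr_ge0 ?(ltW L0)// => /(_ isT isT).
  by rewrite exprMn !enorm_sqr !dotvE; lra.
rewrite ler_norml lerNl -dotvNl !dotv_le_sqr//.
by rewrite dotvNl dotvNr opprK.
Qed.

(** Along the segment from [a] to [a + v] the slope of [f] differs from its
    initial value by at most [L t |v|^2] at time [t]; integrating gives the
    factor [L / 2]. *)
Lemma taylor_lipschitz_grad (R : realType) (n : nat) (L : R)
  (f : 'rV[R]_n -> R) (a v : 'rV[R]_n) :
  0 < L -> (forall u, differentiable f u) -> lipschitz_grad L f ->
  `|f (a + v) - f a - dotv (grad f a) v| <= L / 2 * dotv v v.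
Proof.
move=> L0 df lipf.
have dline t := is_derive_line (df (a + t *: v)).
have slope t : 0 < t < 1 ->
    `|dotv (grad f (a + t *: v)) v - dotv (grad f a) v| <= L * t * dotv v v.
  by move=> /andP[t0 _]; rewrite -dotvNl -dotvDl; exact: lipschitz_grad_dotv.
have lo := @affine_derive_growth _ _ _
  (dotv (grad f a) v) (- (L * dotv v v)) dline.
have up := @affine_derive_growth _ (fun t => - f (a + t *: v)) _
  (- dotv (grad f a) v) (- (L * dotv v v)) (fun t => is_deriveN (dline t)).
rewrite /= scale0r scale1r addr0 in lo up.
rewrite ler_norml; apply/andP; split.
- suff : f a + dotv (grad f a) v + - (L * dotv v v) / 2 <= f (a + v) by lra.
  by apply: lo => t /slope; rewrite ler_norml => /andP[]; lra.
- suff : - f a + - dotv (grad f a) v + - (L * dotv v v) / 2 <= - f (a + v).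
    by lra.
  by apply: up => t /slope; rewrite ler_norml => /andP[]; lra.
Qed.

(** Lets a step length [t] tend to zero: first-order information is extracted
    from the quadratic bounds this way, without computing limits. *)
Lemma le_of_le_add_eps (R : realType) (a b c : R) :
  (forall t, 0 < t <= 1 -> a <= b + t * c) -> a <= b.
Proof.
move=> h; rewrite leNgt; apply/negP => ba.
have c0 : 0 < c by have := h 1; rewrite ltr01 lexx => /(_ isT); lra.
(* Half of the gap between [a] and [b] is left at this [t]. *)
pose t := Num.min 1 ((a - b) / (2 * c)).
have t0 : 0 < t by rewrite lt_min ltr01 divr_gt0//; lra.
have t1 : t <= 1 by rewrite ge_min lexx.
have tc : t * c <= (a - b) / 2.
  rewrite (_ : (a - b) / 2 = (a - b) / (2 * c) * c).
    by rewrite ler_wpM2r ?(ltW c0)// /t ge_min lexx orbT.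
  by field; lra.
by have := h t; rewrite t0 t1 => /(_ isT); lra.
Qed.

(** A negative slope at a minimizer would beat the quadratic error term for a
    short enough step. *)
Lemma grad_argmin (R : realType) (n : nat) (L : R)
  (f : 'rV[R]_n -> R) (xstar : 'rV[R]_n) :
  0 < L -> (forall u, differentiable f u) -> lipschitz_grad L f ->
  argmin f xstar -> forall v, dotv (grad f xstar) v = 0.
Proof.
move=> L0 df lipf fmin.
have slope_ge0 v : 0 <= dotv (grad f xstar) v.
  apply: (@le_of_le_add_eps _ _ _ (L / 2 * dotv v v)) => t /andP[t0 _].
  have := fmin (xstar + t *: v).
  have := taylor_lipschitz_grad xstar (t *: v) L0 df lipf.
  rewrite ler_norml !dotvE => /andP[_ up] le_f.
  rewrite -(ler_pM2l t0); lra.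
move=> v; apply/eqP; rewrite eq_le slope_ge0 andbT.
by have := slope_ge0 (- v); rewrite dotvNr; lra.
Qed.

(** * Strongly quasiconvex functions near their minimizer *)

(** Moving from [z] by a fraction [t] towards [xstar], strong quasiconvexity
    makes [f] drop by at least [t (1 - t) gamma / 2 |z - xstar|^2], since the
    larger of the two end values is [f z].  Compared with the quadratic lower
    bound for [f] and divided by [t], this bounds the slope up to a term
    proportional to [t]. *)
Lemma sqc_grad_argmin (R : realType) (n : nat) (gamma L : R)
  (f : 'rV[R]_n -> R) (xstar z : 'rV[R]_n) :
  0 < L -> (forall u, differentiable f u) -> lipschitz_grad L f ->
  strongly_quasiconvex gamma f -> argmin f xstar ->
  gamma / 2 * dotv (z - xstar) (z - xstar) <= dotv (grad f z) (z - xstar).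
Proof.
move=> L0 df lipf sqc fmin.
set w := z - xstar.
apply: (@le_of_le_add_eps _ _ _ ((gamma + L) / 2 * dotv w w)) => t /andP[t0 t1].
have := sqc z xstar t; rewrite t1 (ltW t0) => /(_ isT).
rewrite max_r ?fmin// enorm_sqr.
have -> : t *: xstar + (1 - t) *: z = z + t *: (- w).
  by rewrite /w scalerBl scale1r opprB scalerBr addrC addrAC addrA.
have := taylor_lipschitz_grad z (t *: - w) L0 df lipf.
rewrite ler_norml !dotvE -/w => /andP[lo _] up.
rewrite -(ler_pM2l t0); lra.
Qed.

(** At time [t] on the segment from [xstar] to [x] the slope of [f] is at least
    [gamma / 2 t |x - xstar|^2] by [sqc_grad_argmin]; integration halves the
    constant.  Strong quasiconvexity evaluated at the midpoint alone would only
    give [gamma / 8]. *)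
Lemma quadratic_growth (R : realType) (n : nat) (gamma L : R)
  (f : 'rV[R]_n -> R) (xstar x : 'rV[R]_n) :
  0 < L -> (forall u, differentiable f u) -> lipschitz_grad L f ->
  strongly_quasiconvex gamma f -> argmin f xstar ->
  gamma / 4 * dotv (x - xstar) (x - xstar) <= f x - f xstar.
Proof.
move=> L0 df lipf sqc fmin.
set w := x - xstar; have xE : xstar + w = x by rewrite addrC subrK.
clearbody w.
have dline t := is_derive_line (df (xstar + t *: w)).
have := @affine_derive_growth _ _ _ 0 (gamma / 2 * dotv w w) dline.
rewrite /= scale0r scale1r !addr0 xE => growth.
suff : f xstar + gamma / 2 * dotv w w / 2 <= f x by lra.
apply: growth => t /andP[t0 _].
have := sqc_grad_argmin (xstar + t *: w) L0 df lipf sqc fmin.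
rewrite [xstar + _]addrC addrK !dotvE => slope.
by rewrite -(ler_pM2l t0); lra.
Qed.

(** The distance to [xstar] is at most [2 / gamma] times the norm of the
    gradient, and [f z - f xstar] at most [L / 2] times the square of that
    distance. *)
Lemma polyak_lojasiewicz (R : realType) (n : nat) (gamma L : R)
  (f : 'rV[R]_n -> R) (xstar z : 'rV[R]_n) :
  0 < gamma ->
  0 < L -> (forall u, differentiable f u) -> lipschitz_grad L f ->
  strongly_quasiconvex gamma f -> argmin f xstar ->
  f z - f xstar <= 2 * L / gamma ^+ 2 * dotv (grad f z) (grad f z).
Proof.
move=> g0 L0 df lipf sqc fmin.
have := taylor_lipschitz_grad xstar (z - xstar) L0 df lipf.
rewrite (grad_argmin L0 df lipf fmin) [xstar + _]addrC subrK subr0.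
rewrite ler_norml => /andP[_ up].
have := sqr_le_dotv (ltW (divr_gt0 g0 (ltr0n R 2)))
  (sqc_grad_argmin z L0 df lipf sqc fmin).
set W := dotv (z - _) _ in up *; set G := dotv _ _ => wg.
apply: (le_trans up).
rewrite (_ : L / 2 * W = 2 * L / gamma ^+ 2 * ((gamma / 2) ^+ 2 * W)).
  by rewrite ler_wpM2l// ltW// divr_gt0 ?mulr_gt0 ?exprn_gt0.
by field; lra.
Qed.

(** * Energy decay of the momentum method *)

(** The quadratic upper bound takes [f] from [z = x + beta d] to the new point,
    the lower one takes it from [z] back to [x].  Since
    [<g, d'> = alpha <g, d> - |g|^2 / L], the two together contain
    [beta <g, d>], which is cancelled by the cross term of
    [L beta / (2 alpha) |d'|^2]. *)
Lemma momentum_step_decrease (R : realType) (n : nat) (L alpha beta : R)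
  (f : 'rV[R]_n -> R) (x d : 'rV[R]_n) :
  0 < L -> 0 < alpha ->
  (forall u, differentiable f u) -> lipschitz_grad L f ->
  let g := grad f (x + beta *: d) in
  let d' := alpha *: d - (1 / L) *: g in
  f (x + d') + L * beta / (2 * alpha) * dotv d' d'
  <= f x + L * beta / (2 * alpha) * dotv d d
     - 1 / (2 * L) * (1 - beta / alpha) * dotv g g
     - L / (2 * alpha)
         * ((alpha ^+ 2 + 1) * beta - 4 * alpha * beta ^+ 2 - alpha ^+ 3)
         * dotv d d.
Proof.
move=> L0 a0 df lipf /=; set g := grad f _; set d' := _ - _.
have := taylor_lipschitz_grad (x + beta *: d) (- (beta *: d)) L0 df lipf.
have := taylor_lipschitz_grad (x + beta *: d) (d' - beta *: d) L0 df lipf.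
rewrite addrK addrACA subrr addr0 -/g.
rewrite !ler_norml => /andP[_ up] /andP[lo _].
move: up lo; rewrite /d' !dotvE (dotvC d g).
set G := dotv g g; set P := dotv g d; have := dotv_ge0 d; set D := dotv d d.
move=> D0 up lo.
(* The bounds below give the coefficient [2 alpha beta ^+ 2] where the
   statement has [4 alpha beta ^+ 2]; this summand is the difference. *)
have slack : 0 <= L * beta ^+ 2 * D.
  by rewrite mulr_ge0 // mulr_ge0 ?sqr_ge0 ?ltW.
rewrite -subr_ge0 in up; rewrite -subr_ge0 in lo.
rewrite -subr_ge0; have := addr_ge0 slack (addr_ge0 up lo).
by congr (0 <= _); field; rewrite !gt_eqF.
Qed.

(** Passing from [f x] to [f z] costs [- beta <g, d>] up to a quadratic term;
    it is split by [- <g, d> <= (|g|^2 + |d|^2) / 2], and [f z] is handled by the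
    Polyak-Lojasiewicz inequality. *)
Lemma energy_bound (R : realType) (n : nat) (gamma L alpha beta : R)
  (f : 'rV[R]_n -> R) (xstar x d : 'rV[R]_n) :
  0 < gamma -> 0 < L -> 0 <= beta ->
  (forall u, differentiable f u) -> lipschitz_grad L f ->
  strongly_quasiconvex gamma f -> argmin f xstar ->
  let g := grad f (x + beta *: d) in
  f x - f xstar + L * beta / (2 * alpha) * dotv d d
  <= (2 * L / gamma ^+ 2 + beta / 2) * dotv g g
     + beta / 2 * (1 + L * beta + L / alpha) * dotv d d.
Proof.
move=> g0 L0 b0 df lipf sqc fmin /=; set g := grad f _.
have := polyak_lojasiewicz (x + beta *: d) g0 L0 df lipf sqc fmin.
have := taylor_lipschitz_grad (x + beta *: d) (- (beta *: d)) L0 df lipf.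
rewrite addrK ler_norml -/g !dotvE => /andP[_ up] pl.
have := mulr_ge0 b0 (dotv_ge0 (g + d)).
rewrite !dotvE (dotvC d g) invfM; lra.
Qed.

(** If [q < 0], nonnegativity forces the sequence to vanish, so the ratio may
    have any sign. *)
Lemma geometric_decay (R : realType) (E : nat -> R) (q : R) :
  (forall k, 0 <= E k) -> (forall k, E k.+1 <= q * E k) ->
  forall k, E k <= E 0 * q ^+ k.
Proof.
move=> E0 Eq; have [q0|q0] := leP 0 q.
  elim=> [|k IH]; first by rewrite expr0 mulr1.
  rewrite exprS mulrCA; apply: le_trans (Eq k) _; exact: ler_wpM2l.
have Ez k : E k = 0.
  apply/eqP; rewrite eq_le E0 andbT leNgt; apply/negP => Ek0.
  by have := le_trans (E0 k.+1) (Eq k); rewrite leNgt nmulr_rlt0// Ek0.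
by move=> k; rewrite !Ez mul0r.
Qed.

(** The two bounds on [beta] are the roots of
    [4 alpha X^2 - (1 + alpha^2) X + alpha^3]; [alpha < 1 / 2] makes the
    discriminant nonnegative, so that the square root is genuine. *)
Lemma beta_window (R : realType) (alpha beta : R) :
  0 < alpha < 1 / 2 ->
  (1 + alpha ^+ 2
    - Num.sqrt (- 15 * alpha ^+ 4 + 2 * alpha ^+ 2 + 1)) / (8 * alpha) < beta ->
  beta < (1 + alpha ^+ 2
    + Num.sqrt (- 15 * alpha ^+ 4 + 2 * alpha ^+ 2 + 1)) / (8 * alpha) ->
  0 < (alpha ^+ 2 + 1) * beta - 4 * alpha * beta ^+ 2 - alpha ^+ 3.
Proof.
move=> /andP[a0 a1].
have a8 : 0 < 8 * alpha by lra.
rewrite ltr_pdivrMr// ltr_pdivlMr//.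
set D := _ + 1; set S := Num.sqrt D => lo up.
have D0 : 0 <= D.
  have a2 : 0 <= alpha ^+ 2 <= 1 / 4 by apply/andP; split; nra.
  by rewrite /D (_ : alpha ^+ 4 = alpha ^+ 2 * alpha ^+ 2); [nra|ring].
have SD : S ^+ 2 = D by exact: sqr_sqrtr.
have lo' : 0 < beta * (8 * alpha) - (1 + alpha ^+ 2 - S) by lra.
have up' : 0 < (1 + alpha ^+ 2 + S) - beta * (8 * alpha) by lra.
have -> : (alpha ^+ 2 + 1) * beta - 4 * alpha * beta ^+ 2 - alpha ^+ 3
    = (S ^+ 2 - (8 * alpha * beta - (1 + alpha ^+ 2)) ^+ 2) / (16 * alpha).
  by rewrite SD /D; field; lra.
by apply: divr_gt0; [have := mulr_gt0 lo' up'|]; lra.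
Qed.

Theorem theorem4p1 (R : realType) (n : nat) (f : 'rV[R]_n -> R)
  (gamma L s alpha beta : R)
  (gamma_gt0 : 0 < gamma) (L_gt0 : 0 < L)
  (f_diff : forall u : 'rV[R]_n, differentiable f u)
  (f_sqc : strongly_quasiconvex gamma f)
  (f_lip : lipschitz_grad L f)
  (sE : s = 1 / L)
  (alpha_bounds : 0 < alpha < 1 / 2)
  (beta_lower :
    (1 + alpha ^+ 2
      - Num.sqrt (- 15 * alpha ^+ 4 + 2 * alpha ^+ 2 + 1)) / (8 * alpha) < beta)
  (beta_upper :
    beta < Num.min alpha
      ((1 + alpha ^+ 2
        + Num.sqrt (- 15 * alpha ^+ 4 + 2 * alpha ^+ 2 + 1)) / (8 * alpha)))
  (x y z : nat -> 'rV[R]_n)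
  (yE : forall k : nat, (1 <= k)%N -> y k = x k + alpha *: (x k - x (k - 1)%N))
  (zE : forall k : nat, (1 <= k)%N -> z k = x k + beta *: (x k - x (k - 1)%N))
  (xE : forall k : nat, (1 <= k)%N -> x (k + 1)%N = y k - s *: grad f (z k))
  (xstar : 'rV[R]_n) (xstar_argmin : argmin f xstar) :
  let E1 := f (x 1%N) - f xstar
            + L * beta / (2 * alpha) * enorm (x 1%N - x 0%N) ^+ 2 in
  let rho :=
    Num.min
      ((1 / (2 * L) * (1 - beta / alpha))
         / (2 * L / gamma ^+ 2 + beta / 2))
      ((L / (2 * alpha)
          * ((alpha ^+ 2 + 1) * beta - 4 * alpha * beta ^+ 2 - alpha ^+ 3))
         / (beta / 2 * (1 + L * beta + L / alpha))) in
  forall k : nat, (1 <= k)%N ->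
    [/\ f (x k) - f xstar <= E1 * (1 - rho) ^+ (k - 1),
        enorm (x k - xstar) ^+ 2 <= 4 * E1 / gamma * (1 - rho) ^+ (k - 1)
      & enorm (x k - x (k - 1)%N) ^+ 2
          <= 2 * alpha * E1 / (L * beta) * (1 - rho) ^+ (k - 1)].
Proof.
move=> E1 rho.
have [a0 _] := andP alpha_bounds.
move: beta_upper; rewrite lt_min => /andP[ba beta_upper'].
have c2_gt0 := beta_window alpha_bounds beta_lower beta_upper'.
(* The positive quantity [c2_gt0] is [(alpha ^+ 2 + 1) * beta] minus
   nonnegative terms. *)
have b0 : 0 < beta by nra.
pose c1 := 1 / (2 * L) * (1 - beta / alpha).
pose c2 := L / (2 * alpha)
  * ((alpha ^+ 2 + 1) * beta - 4 * alpha * beta ^+ 2 - alpha ^+ 3).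
have A_gt0 : 0 < 2 * L / gamma ^+ 2 + beta / 2.
  by rewrite addr_gt0// divr_gt0// ?mulr_gt0// exprn_gt0.
have B_gt0 : 0 < beta / 2 * (1 + L * beta + L / alpha).
  have Lb := mulr_gt0 L_gt0 b0; have La := divr_gt0 L_gt0 a0.
  by apply: mulr_gt0; lra.
have rho_ge0 : 0 <= rho.
  rewrite le_min; apply/andP; split; apply: divr_ge0;
    rewrite ?(ltW A_gt0) ?(ltW B_gt0)//.
    rewrite mulr_ge0 ?divr_ge0 ?mulr_ge0 ?(ltW L_gt0)// subr_ge0.
    by rewrite ler_pdivrMr// mul1r ltW.
  by rewrite mulr_ge0 ?(ltW c2_gt0)// divr_ge0 ?mulr_ge0 ?ltW.
have rho_A : rho * (2 * L / gamma ^+ 2 + beta / 2) <= c1.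
  by rewrite -ler_pdivlMr// ge_min lexx.
have rho_B : rho * (beta / 2 * (1 + L * beta + L / alpha)) <= c2.
  by rewrite -ler_pdivlMr// ge_min lexx orbT.
(* Indices are shifted by one: [d k] and [E k] belong to the iterate
   [x k.+1]. *)
pose d k := x k.+1 - x k.
pose E k := f (x k.+1) - f xstar + L * beta / (2 * alpha) * dotv (d k) (d k).
have coef_gt0 : 0 < L * beta / (2 * alpha) by rewrite divr_gt0// mulr_gt0.
have fE k : f (x k.+1) - f xstar <= E k.
  by rewrite lerDl mulr_ge0 ?dotv_ge0// ltW.
have dE k : L * beta / (2 * alpha) * dotv (d k) (d k) <= E k.
  by rewrite lerDr subr_ge0.
have E_ge0 k : 0 <= E k by rewrite (le_trans _ (fE k))// subr_ge0.
have step k : x k.+2 = x k.+1 +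
    (alpha *: d k - (1 / L) *: grad f (x k.+1 + beta *: d k)).
  by have := xE k.+1 isT; rewrite addn1 yE// zE// sE subn1 /= addrA.
have E_decay k : E k.+1 <= (1 - rho) * E k.
  have := momentum_step_decrease beta (x k.+1) (d k) L_gt0 a0 f_diff f_lip.
  have := energy_bound alpha (x k.+1) (d k) gamma_gt0 L_gt0 (ltW b0)
    f_diff f_lip f_sqc xstar_argmin.
  have dS : d k.+1 = alpha *: d k - (1 / L) *: grad f (x k.+1 + beta *: d k).
    by rewrite /d step addrAC subrr add0r.
  rewrite /= -step -dS -/(E k).
  set G := dotv (grad _ _) _; set D := dotv (d k) _ => Ele decr.
  have rho_le : rho * E k <= c1 * G + c2 * D.
    apply: le_trans (ler_wpM2l rho_ge0 Ele) _.
    by rewrite mulrDr lerD// mulrA ler_wpM2r ?dotv_ge0.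
  have EkE : E k = f (x k.+1) - f xstar + L * beta / (2 * alpha) * D by [].
  rewrite mulrBl mul1r {1}/E; move: rho_le decr; rewrite /c1 /c2; lra.
have E_le k : E k <= E1 * (1 - rho) ^+ k.
  have -> : E1 = E 0 by rewrite /E1 enorm_sqr.
  exact: geometric_decay.
case=> // k _; rewrite subn1 /= !enorm_sqr; split.
- exact: le_trans (fE k) (E_le k).
- have := quadratic_growth (x k.+1) L_gt0 f_diff f_lip f_sqc xstar_argmin.
  move=> /le_trans /(_ (le_trans (fE k) (E_le k))) bound.
  have gamma4 : 0 < gamma / 4 by rewrite divr_gt0.
  rewrite -(ler_pM2l gamma4); move: bound; congr (_ <= _).
  by field; rewrite gt_eqF.
- have bound := le_trans (dE k) (E_le k).
  rewrite -(ler_pM2l coef_gt0); move: bound; congr (_ <= _).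
  by field; rewrite !gt_eqF.
Qed.
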